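(* Let $\mathcal{X}$ be a stochastic, irreducible and aperiodic homogeneous discrete-time Markov chain on a countably infinite state space $S$. If $\mathcal{X}$ is simple and nonatomic, then $\mathcal{X}$ is asymptotically aperiodic.
   Context: $\mathcal{X}=\{X(n),\,n=0,1,\dots\}$ has an arbitrary initial distribution, and $\mathbb{P}$ is the induced probability measure on sample paths. For $m\ge 1$, $\mathcal{X}^{(m)}=\{X^{(m)}(n)=X(nm),\ n=0,1,\dots\}$ is the $m$-step chain. For a Markov chain $\mathcal{Y}=\{Y(n)\}$ on $S$ (here $\mathcal{X}$ or some $\mathcal{X}^{(m)}$) and $C\subset S$ let $U(C)=\{Y(n)\in C \text{ for infinitely many } n\}$ and $L(C)=\{Y(n)\in C\text{ for all sufficiently large }n\}$. $C$ is transient (w.r.t. $\mathcal{Y}$) if $\mathbb{P}(U(C))=0$; regular if $\mathbb{P}(U(C)\setminus L(C))=0$; almost closed if it is regular and not transient. These notions do not depend on the initial distribution. An almost closed set is atomic if it does not contain two disjoint almost closed subsets, and nonatomic otherwise. Two regular sets are equivalent if their symmetric difference is transient. A Blackwell decomposition of $S$ for $\mathcal{Y}$ is a finite or countable collection $\{C_1,C_2,\dots\}$ of disjoint almost closed sets such that (i) every $C_i$, except at most one, is atomic; (ii) the nonatomic $C_i$, if present, contains no atomic subsets and consists of transient states; (iii) $\sum_i\mathbb{P}(L(C_i))=1$. By a theorem of Blackwell such a decomposition exists and is unique up to equivalence; $\beta(\mathcal{Y})$ denotes the number of sets in it. $\mathcal{Y}$ is simple if $\beta(\mathcal{Y})=1$;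 a simple chain is called atomic or nonatomic according to whether $S$ (as an almost closed set for it) is atomic or nonatomic. The asymptotic period of a simple chain $\mathcal{X}$ is $d(\mathcal{X}):=\sup\{m\ge1 : \beta(\mathcal{X}^{(m)})=m\}\in\{1,2,\dots\}\cup\{\infty\}$; $\mathcal{X}$ is asymptotically aperiodic if $d(\mathcal{X})=1$. *)

(* Defs.v *)
From HB Require Import structures.
From mathcomp Require Import all_boot all_order all_algebra.
From mathcomp Require Import all_classical all_reals all_analysis.

Set Implicit Arguments.
Unset Strict Implicit.
Unset Printing Implicit Defensive.

Import Order.TTheory GRing.Theory Num.Theory.

Local Open Scope classical_set_scope.
Local Open Scope ring_scope.
Local Open Scope ereal_scope.

Section TransitionMatrix.
Context {R : realType} {S : countType}.
Implicit Types (p : S -> S -> R) (i j : S).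

Definition stochastic p :=
  (forall i j, (0 <= p i j)%R) /\
  (forall i, \esum_(j in [set: S]) (p i j)%:E = 1).

Fixpoint nstep p (n : nat) i j : \bar R :=
  if n is n'.+1 then \esum_(k in [set: S]) ((p i k)%:E * nstep p n' k j)
  else (i == j)%:R%:E.

Definition irreducible p := forall i j, exists n, 0 < nstep p n i j.

(* g is the greatest common divisor of the set of possible return times to i *)
Definition is_period p i (g : nat) :=
  (forall n, (0 < n)%N -> 0 < nstep p n i i -> (g %| n)%N) /\
  (forall e : nat,
     (forall n, (0 < n)%N -> 0 < nstep p n i i -> (e %| n)%N) -> (e %| g)%N).

Definition aperiodic p := forall i, is_period p i 1.

End TransitionMatrix.

Section Process.
Context {R : realType} {S : countType} {d : measure_display}
  {T : measurableType d}.
Variable P : probability T R.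
Implicit Types (p : S -> S -> R) (X Y : nat -> T -> S) (A B C : set S)
  (D : set (set S)).

(* The initial distribution is the law of X 0, which is left arbitrary.
   Since S is countable, measurability of X n for the discrete sigma-algebra
   amounts to measurability of the events {X n = i}. *)
Definition markov_chain p X :=
  (forall n i, measurable (X n @^-1` [set i])) /\
  (forall n (s : nat -> S) j,
     P ([set w | forall k, (k <= n)%N -> X k w = s k]
          `&` (X n.+1 @^-1` [set j]))
     = P [set w | forall k, (k <= n)%N -> X k w = s k] * (p (s n) j)%:E).

Definition mstep (m : nat) X : nat -> T -> S := fun n => X (n * m)%N.

(* {Y n \in C for infinitely many n} *)
Definition Uev Y C : set T :=
  [set w | forall N, exists2 n, (N <= n)%N & C (Y n w)].

(* {Y n \in C for all sufficiently large n} *)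
Definition Lev Y C : set T :=
  [set w | exists N, forall n, (N <= n)%N -> C (Y n w)].

Definition transient Y C := P (Uev Y C) = 0.

Definition regular Y C := P (Uev Y C `\` Lev Y C) = 0.

Definition almost_closed Y C := regular Y C /\ ~ transient Y C.

Definition splits Y C := exists A B,
  [/\ A `<=` C, B `<=` C, A `&` B = set0, almost_closed Y A
    & almost_closed Y B].

Definition atomic Y C := almost_closed Y C /\ ~ splits Y C.

Definition nonatomic Y C := almost_closed Y C /\ splits Y C.

(* Transience of a state i is transience of {i}: i is almost surely visited
   only finitely often. *)
Definition blackwell_decomposition Y D :=
  [/\ countable D /\ trivIset D id,
      forall C, D C -> almost_closed Y C,
      forall C C', D C -> D C' -> ~ atomic Y C -> ~ atomic Y C' -> C = C',
      forall C, D C -> nonatomic Y C ->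
        (forall A, A `<=` C -> ~ atomic Y A) /\
        (forall i, C i -> transient Y [set i])
    & \esum_(C in D) P (Lev Y C) = 1].

(* The number of sets of a Blackwell decomposition (+oo if there are infinitely
   many), computed on a chosen one: decompositions exist and are unique up to
   equivalence. *)
Definition beta Y : \bar R :=
  counting (xget set0 [set D | blackwell_decomposition Y D]).

Definition simple Y := beta Y = 1.

Definition simple_nonatomic Y := simple Y /\ nonatomic Y [set: S].

Definition asymptotic_period X : \bar R :=
  ereal_sup [set m%:R%:E | m in
    [set m : nat | (1 <= m)%N /\ beta (mstep m X) = m%:R%:E]].

Definition asymptotically_aperiodic X := asymptotic_period X = 1.

End Process.

(* Main.v *)
(* Suppose that C is atomic for the m-step process Y of X. Every set regular for
   X is regular for Y, so, C being atomic, each regular set of X either contains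
   C or is disjoint from it, up to sets transient for Y. Among the regular sets
   of X that contain C in this sense, one, say B, minimizes P(L(B)): since every
   state is transient, the regular sets of X are closed under countable
   intersection up to equivalence. As X is nonatomic, B contains two disjoint
   almost closed sets of X; C is essentially disjoint from one of them, and
   removing that one from B contradicts minimality. Hence no m-step process has
   an atomic set, whereas a Blackwell decomposition into m >= 2 sets would
   provide one. *)

Require Import Defs.
From mathcomp Require Import all_boot all_order all_algebra.
From mathcomp Require finmap.
From mathcomp Require Import all_classical all_reals all_analysis.

Set Implicit Arguments.
Unset Strict Implicit.
Unset Printing Implicit Defensive.

Import Order.TTheory GRing.Theory Num.Theory.

Local Open Scope classical_set_scope.
Local Open Scope ring_scope.
Local Open Scope ereal_scope.

(** * Comparison and continuity of probabilities *)

Section AlmostEverywhere.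
Context {R : realType} {d : measure_display} {T : measurableType d}.
Variable P : probability T R.

Lemma ae_le_measure (E F : set T) : measurable E -> measurable F ->
  (\forall w \ae P, E w -> F w) -> P E <= P F.
Proof.
move=> mE mF EF.
have EF0 : P (E `\` F) = 0.
  apply: measure_negligible; first exact: measurableD.
  by apply: negligibleS EF => w [Ew nFw] /= /(_ Ew).
rewrite -(measureU0 mF (measurableD mE mF) EF0) le_measure ?inE //.
  by apply: measurableU => //; exact: measurableD.
by move=> w Ew; have [|] := pselect (F w); [left|right].
Qed.

(** Continuity from above, in the form that yields a threshold index for a prescribed error. *)
Lemma nonincreasing_measure_lt (E : (set T)^nat) (e : R) :
  (forall k, measurable (E k)) -> {homo E : m n / (m <= n)%N >-> n `<=` m} ->
  \bigcap_k E k = set0 -> (0 < e)%R -> exists k, P (E k) < e%:E.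
Proof.
move=> mE decE E0 e0.
have : (P \o E) x @[x --> \oo] --> P (\bigcap_k E k).
  apply: nonincreasing_cvg_mu => //.
  - exact: le_lt_trans (probability_le1 _ _) (ltry _).
  - exact: bigcap_measurable.
  - by move=> m n mn; apply/subsetPset; exact: decE.
rewrite E0 measure0 => /fine_cvgP[_ /cvgrPdist_lt /(_ e e0)].
move=> [k _ /(_ k (leqnn _))] /=.
rewrite sub0r normrN ger0_norm ?fine_ge0 // => ke.
by exists k; rewrite -(fineK (fin_num_measure P _ (mE k))) lte_fin.
Qed.

End AlmostEverywhere.

(** * Pathwise properties of eventual membership *)

Section Paths.
Context {S : countType} {d : measure_display} {T : measurableType d}.
Implicit Types (Y : nat -> T -> S) (A B : set S) (w : T).

Lemma UevE Y A : Uev Y A = ~` Lev Y (~` A).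
Proof.
apply/seteqP; split => w /=.
  by move=> UA [N LA]; have [n Nn] := UA N; exact: LA.
move=> nL N; apply: contrapT => nU; apply: nL; exists N => n Nn An.
by apply: nU; exists n.
Qed.

Lemma LevS Y A B : A `<=` B -> Lev Y A `<=` Lev Y B.
Proof. by move=> AB w [N LA]; exists N => n /LA; exact: AB. Qed.

Lemma LevI Y A B : Lev Y (A `&` B) = Lev Y A `&` Lev Y B.
Proof.
apply/seteqP; split => w /=.
  by move=> L; split; apply: LevS L => i [].
move=> [[N LA] [M LB]]; exists (maxn N M) => n; rewrite geq_max => /andP[Nn Mn].
by split; [exact: LA|exact: LB].
Qed.

Lemma Lev0 Y : Lev Y set0 = set0.
Proof. by rewrite -subset0 => w [N /(_ N (leqnn _))]. Qed.

Lemma Lev_disjoint Y A B w : A `&` B = set0 -> Lev Y A w -> ~ Lev Y B w.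
Proof.
move=> AB LA LB; have : Lev Y (A `&` B) w by rewrite LevI.
by rewrite AB Lev0.
Qed.

Lemma Lev_mstep m Y A : (0 < m)%N -> Lev Y A `<=` Lev (mstep m Y) A.
Proof.
move=> m0 w [N LA]; exists N => n Nn; apply: LA.
by rewrite (leq_trans Nn) // leq_pmulr.
Qed.

Lemma mstep1 Y : mstep 1 Y = Y.
Proof. by apply/funext => n; rewrite /mstep muln1. Qed.

End Paths.

(** * Regular sets modulo null events, and what a Blackwell decomposition provides *)

Section RegularSets.
Context {R : realType} {S : countType} {d : measure_display}
  {T : measurableType d}.
Variables (P : probability T R) (Y : nat -> T -> S).
Hypothesis mY : forall n i, measurable (Y n @^-1` [set i]).
Implicit Types (A B C : set S).

Lemma measurable_visit n A : measurable (Y n @^-1` A).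
Proof.
have -> : Y n @^-1` A =
    \bigcup_i (if `[< A i >] then Y n @^-1` [set i] else set0).
  apply/seteqP; split => [w Aw|w [i _]].
    by exists (Y n w) => //=; case: asboolP.
  by case: asboolP => //= Ai ->.
apply: countable_bigcupT_measurable => // i.
by case: ifP.
Qed.

Lemma measurable_Lev A : measurable (Lev Y A).
Proof.
have -> : Lev Y A = \bigcup_N \bigcap_(n in [set n | (N <= n)%N]) (Y n @^-1` A).
  by apply/seteqP; split => [w [N LA]|w [N _ LA]]; exists N.
apply: bigcupT_measurable => N; apply: bigcap_measurable.
  by exists N => /=.
by move=> n _; exact: measurable_visit.
Qed.

Lemma measurable_Uev A : measurable (Uev Y A).
Proof. by rewrite UevE; apply: measurableC; exact: measurable_Lev. Qed.

(** By [UevE], the exceptional event consists of the paths that settle neither in A nor in its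
    complement, so regularity can be handled through [Lev] alone. *)
Lemma regularP A :
  regular P Y A <-> \forall w \ae P, Lev Y A w \/ Lev Y (~` A) w.
Proof.
rewrite /regular -negligibleP; last first.
  by apply: measurableD; [exact: measurable_Uev|exact: measurable_Lev].
suff -> : Uev Y A `\` Lev Y A = ~` [set w | Lev Y A w \/ Lev Y (~` A) w] by [].
by rewrite UevE setDE -setCU setUC.
Qed.

Lemma transientP A : transient P Y A <-> \forall w \ae P, Lev Y (~` A) w.
Proof.
rewrite /transient -negligibleP; last exact: measurable_Uev.
by rewrite UevE.
Qed.

Lemma regularC A : regular P Y A -> regular P Y (~` A).
Proof.
move=> /regularP rA; apply/regularP; rewrite setCK.
by apply: filterS rA => w []; [right|left].
Qed.

Lemma regularI A B : regular P Y A -> regular P Y B -> regular P Y (A `&` B).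
Proof.
move=> /regularP rA /regularP rB; apply/regularP; rewrite LevI.
near=> w; have [LA|LA] : Lev Y A w \/ Lev Y (~` A) w by near: w.
  have [LB|LB] : Lev Y B w \/ Lev Y (~` B) w by near: w.
    by left.
  by right; apply: LevS LB => i nB [].
by right; apply: LevS LA => i nA [].
Unshelve. all: by end_near. Qed.

Lemma regularD A B : regular P Y A -> regular P Y B -> regular P Y (A `\` B).
Proof.
by move=> rA rB; rewrite setDE; apply: regularI => //; exact: regularC.
Qed.

(** Otherwise regularity would make almost every path settle in the complement, which is
    transience. *)
Lemma almost_closed_Lev_gt0 A : almost_closed P Y A -> 0 < P (Lev Y A).
Proof.
move=> [/regularP rA nA]; rewrite measure_gt0; apply/eqP => A0; apply: nA.
have {}A0 : P.-negligible (Lev Y A).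
  by apply/negligibleP => //; exact: measurable_Lev.
apply/transientP; apply: filterS2 rA (_ : \forall w \ae P, ~ Lev Y A w).
  by move=> w [].
by apply: negligibleS A0 => w /= /contrapT.
Qed.

(** Serves to cut almost closed sets down to the only member of a one-set decomposition. *)
Lemma almost_closedI A C : (\forall w \ae P, Lev Y C w) ->
  almost_closed P Y A -> almost_closed P Y (A `&` C).
Proof.
move=> LC [rA nA]; split.
  by apply: regularI => //; apply/regularP; apply: filterS LC; left.
apply: contra_not nA => /transientP tAC; apply/transientP.
apply: filterS2 LC tAC => w LC LAC.
have : Lev Y (C `&` ~` (A `&` C)) w by rewrite LevI.
by apply: LevS => i [Ci nACi] Ai; apply: nACi.
Qed.

Lemma splitsS A B : A `<=` B -> splits P Y A -> splits P Y B.
Proof.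
by move=> AB [A1 [A2 [A1A A2A ? ? ?]]]; exists A1, A2; split => //;
  [exact: subset_trans A1A AB|exact: subset_trans A2A AB].
Qed.

(** Members that are not atomic coincide, so a decomposition without atomic member has at most one
    set. *)
Lemma exists_atomic_of_beta (m : nat) : (2 <= m)%N -> beta P Y = m%:R%:E ->
  exists C, atomic P Y C.
Proof.
(* Without any decomposition, [xget] returns [set0] and [beta] is 0, contrary to [m2]. *)
move=> m2; rewrite /beta; case: xgetP => [D _ bD|_]; last first.
  rewrite /counting asboolT // fset_set0 /= => -[] /eqP.
  by rewrite eq_sym pnatr_eq0; case: m m2.
have [_ _ atomD _ _] := bD.
rewrite /counting; case: asboolP => // finD [/eqP]; rewrite eqr_nat => /eqP Dm.
apply: contrapT => noatom.
have sub1 C C' : D C -> D C' -> C = C'.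
  by move=> DC DC'; apply: atomD => // at_; apply: noatom; eexists; exact: at_.
have [C DC] : exists C, D C.
  apply: contrapT => nD; have D0 : D = set0.
    by rewrite -subset0 => C DC; apply: nD; exists C.
  by move: m2; rewrite -Dm D0 fset_set0.
have D1 : D = [set C].
  by apply/seteqP; split => [C' DC'|_ -> //]; exact: sub1.
by move: m2; rewrite -Dm D1 fset_set1 finmap.cardfs1.
Qed.

(** The total mass 1 makes almost every path settle in the only member C of the decomposition. A
    splitting of the whole space therefore restricts to C, and the clause on nonatomic members
    applies to C. *)
Lemma simple_nonatomicP : simple_nonatomic P Y ->
  (forall A, almost_closed P Y A -> splits P Y A) /\
  (forall i, transient P Y [set i]).
Proof.
move=> [+ [_ [A1 [A2 [_ _ A12 ac1 ac2]]]]].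
rewrite /simple /beta; case: xgetP => [D _ bD|_]; last first.
  rewrite /counting asboolT // fset_set0 /= => -[] /eqP.
  by rewrite eq_sym oner_eq0.
have [_ acD _ nonatomD sumD] := bD.
rewrite /counting; case: asboolP => // finD [/eqP].
rewrite pnatr_eq1 => /finmap.cardfs1P[C]; rewrite -fset_set1.
move=> /(fset_set_inj finD (finite_set1 C)) D1.
have DC : D C by rewrite D1.
have LC : \forall w \ae P, Lev Y C w.
  apply/negligibleP; first by apply: measurableC; exact: measurable_Lev.
  transitivity (1 - P (Lev Y C)).
    by rewrite -probability_setC //; exact: measurable_Lev.
  by move: sumD; rewrite D1 esum_set1 // => ->; rewrite subee.
have naC : nonatomic P Y C.
  split; first exact: acD.
  exists (A1 `&` C), (A2 `&` C); split; try by move=> ? [].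
  - by rewrite setIACA A12 set0I.
  - exact: almost_closedI.
  - exact: almost_closedI.
have [noatom transC] := nonatomD C DC naC.
split => [A acA|i].
  apply: contrapT => nsA; apply: (noatom (A `&` C)); first by move=> ? [].
  split; first exact: almost_closedI.
  by apply: contra_not nsA; apply: splitsS => ? [].
have [Ci|nCi] := pselect (C i); first exact: transC.
apply/transientP; apply: filterS LC => w; apply: LevS => j Cj ji.
by apply: nCi; rewrite -ji.
Qed.

(** As [pickle] is injective, each induction step discards at most one transient state. *)
Lemma ae_Lev_pickle : (forall i, transient P Y [set i]) ->
  forall M, \forall w \ae P, Lev Y [set i : S | (M <= pickle i)%N] w.
Proof.
move=> tY; elim=> [|M IH]; first by apply: aeW => w; exists 0%N.
have LM : \forall w \ae P, Lev Y [set i : S | pickle i <> M] w.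
  have [[i iM]|nM] := pselect (exists i : S, pickle i = M).
    have /transientP := tY i; apply: filterS => w; apply: LevS => j /= ji jM.
    by apply: ji; apply: (pcan_inj pickleK); rewrite iM.
  by apply: aeW => w; exists 0%N => n _ /= YM; apply: nM; exists (Y n w).
apply: filterS2 IH LM => w LM1 LM2.
have : Lev Y ([set i : S | (M <= pickle i)%N] `&`
    [set i : S | pickle i <> M]) w.
  by rewrite LevI.
by apply: LevS => i [/= Mi /eqP iM]; rewrite ltn_neqAle eq_sym iM.
Qed.

(* The witness imposes membership in A k only on states of index at least M k,
   where M k is so large that a path eventually in A k breaks this requirement
   with probability at most 2^-(k+1); then Borel-Cantelli applies. *)
Lemma regular_bigcap (A : nat -> set S) :
  (forall i, transient P Y [set i]) -> (forall k, regular P Y (A k)) ->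
  exists B, regular P Y B /\
    \forall w \ae P, Lev Y B w <-> forall k, Lev Y (A k) w.
Proof.
move=> tY rA.
pose E k M := Lev Y (A k) `&`
  \bigcup_n (Y n @^-1` ([set i : S | (M <= pickle i)%N] `\` A k)).
have mE k M : measurable (E k M).
  apply: measurableI; first exact: measurable_Lev.
  by apply: bigcupT_measurable => n; exact: measurable_visit.
have /choice[M PM] k : exists M, P (E k M) < (1 / (2 ^ k.+1)%:R)%:E.
  apply: nonincreasing_measure_lt => //.
  - move=> M N MN w [LA [n _ [/= Nn nA]]]; split => //; exists n => //.
    by split => //=; exact: leq_trans Nn.
  - rewrite -subset0 => w Ew; have [[N LA] _] := Ew 0%N I.
    (* A visit outside [A k] can only occur before time N; a threshold above all indices visited by
       then rules it out. *)
    have [_ [n _ [/=]]] := Ew (\max_(n < N) pickle (Y n w)).+1 I.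
    have [Nn _|nN + _] := leqP N n; first by apply; exact: LA.
    by rewrite ltnNge (leq_bigmax (Ordinal nN)).
have limE : \forall w \ae P, ~ lim_sup_set (fun k => E k (M k)) w.
  apply: (@negligibleS _ _ _ _ (lim_sup_set (fun k => E k (M k)))).
    by move=> w /= /contrapT.
  apply/negligibleP.
    apply: bigcap_measurable => // n _; exact: bigcup_measurable.
  apply: lim_sup_set_cvg0; first by move=> k; exact: mE.
  apply: (@le_lt_trans _ _ 1%:E); last exact: ltry.
  apply: le_trans (epsilon_trick0 xpredT ler01).
  by apply: lee_nneseries => [k _ _|k _]; [exact: measure_ge0|exact/ltW/PM].
exists [set i : S | forall k, (M k <= pickle i)%N -> A k i].
set B := [set i | _].
have cases : \forall w \ae P,
    (Lev Y B w /\ forall k, Lev Y (A k) w) \/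
    (Lev Y (~` B) w /\ exists k, Lev Y (~` A k) w).
  have /ae_foralln : forall k, \forall w \ae P,
      Lev Y (A k) w \/ Lev Y (~` A k) w.
    by move=> k; exact/regularP.
  have /ae_foralln := ae_Lev_pickle tY.
  apply: filterS3 limE => w nlim Lp LA.
  have [allA|/existsNP[k nLAk]] := pselect (forall k, Lev Y (A k) w).
    left; split => //.
    have [k0 goodE] : exists k0, forall k, (k0 <= k)%N -> ~ E k (M k) w.
      apply: contrapT => nk0; apply: nlim => n _; apply: contrapT => nE.
      by apply: nk0; exists n => k nk Ek; apply: nE; exists k.
    (* Borel-Cantelli leaves out the finitely many k below [k0]; these get a common settling
       time. *)
    have [N LN] : exists N, forall n, (N <= n)%N ->
        forall k, (k < k0)%N -> A k (Y n w).
      elim: {goodE} k0 => [|k0 [N LN]]; first by exists 0%N.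
      have [N' LN'] := allA k0; exists (maxn N N') => n.
      rewrite geq_max => /andP[Nn N'n] k; rewrite ltnS leq_eqVlt.
      by move=> /orP[/eqP ->|]; [exact: LN'|exact: LN].
    exists N => n Nn k Mk; have [k0k|] := leqP k0 k; last exact: LN.
    apply: contrapT => nA; apply: (goodE k k0k); split => //.
    by exists n.
  have {}nLAk : Lev Y (~` A k) w by case: (LA k).
  right; split; last by exists k.
  (* Transience of states drives the path to indices at least [M k], where membership in B would
     force membership in [A k]. *)
  have : Lev Y ([set i : S | (M k <= pickle i)%N] `&` ~` A k) w by rewrite LevI.
  by apply: LevS => i [/= Mi nA] Bi; apply: nA; exact: Bi.
split.
  by apply/regularP; apply: filterS cases => w [[]|[]]; [left|right].
apply: filterS cases => w [[LB LA]//|[LB [k nA]]]; split => [LB'|LA].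
  by case: (Lev_disjoint (setICr B) LB').
by case: (Lev_disjoint (setICr (A k)) (LA k)).
Qed.

End RegularSets.

(** * Absence of atomic sets for the m-step processes *)

Section Skeleton.
Context {R : realType} {S : countType} {d : measure_display}
  {T : measurableType d}.
Variables (P : probability T R) (X : nat -> T -> S).
Hypothesis mX : forall n i, measurable (X n @^-1` [set i]).

Lemma regular_mstep m A : (0 < m)%N -> regular P X A -> regular P (mstep m X) A.
Proof.
move=> m0 /(regularP P mX) rA; apply/regularP; first by move=> n i; exact: mX.
by apply: filterS rA => w [] /(Lev_mstep m0); [left|right].
Qed.

Lemma mstep_not_atomic m C : (0 < m)%N ->
  (forall i, transient P X [set i]) ->
  (forall A, almost_closed P X A -> splits P X A) ->
  ~ atomic P (mstep m X) C.
Proof.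
move=> m0 tX splitX [[rC ntC] nsC]; set Y := mstep m X.
have mY : forall n i, measurable (Y n @^-1` [set i]) by move=> n i; exact: mX.
(* Since A is regular for X, almost every path settling in A along Y also does so along X; hence
   containment up to Y-transient sets can be phrased with [Lev X A]. *)
pose contains A := regular P X A /\ \forall w \ae P, Lev Y C w -> Lev X A w.
pose V := [set P (Lev X A) | A in contains].
have remove A A' : contains A -> A' `<=` A -> almost_closed P X A' ->
    transient P Y (C `&` A') -> exists2 v, V v & v < P (Lev X A).
  move=> [rA cA] A'A acA' /(transientP P mY) tA'.
  have rA' := acA'.1.
  exists (P (Lev X (A `\` A'))).
    exists (A `\` A') => //; split; first exact: regularD.
    move/(regularP P mX) : rA' => rA'.
    apply: filterS3 cA tA' rA' => w {}cA {}tA' {}rA' LC.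
    rewrite setDE LevI; split; first exact: cA.
    (* A path settling in A' along X would settle in it along Y, hence in the transient intersection
       of C and A'. *)
    case: rA' => // /(Lev_mstep m0) LA'.
    have := Lev_disjoint (setICr (C `&` A')) _ tA'.
    by rewrite LevI => /(_ (conj LC LA')).
  have mL B : measurable (Lev X B) by exact: measurable_Lev.
  rewrite -(fineK (fin_num_measure P _ (mL (A `\` A')))).
  (* The removal costs at least the positive probability of settling in A'. *)
  apply: (@lt_le_trans _ _ (P (Lev X (A `\` A')) + P (Lev X A'))).
    rewrite fineK ?fin_num_measure // lteDl ?fin_num_measure //.
    exact: almost_closed_Lev_gt0.
  rewrite -measureU //.
    apply: le_measure; rewrite ?inE //; first exact: measurableU.
    by move=> w [|]; apply: LevS => // i [].
  by rewrite -LevI setDE -setIA setICl setI0 Lev0.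
have infV_fin : ereal_inf V \is a fin_num.
  rewrite ge0_fin_numE.
    apply: (@le_lt_trans _ _ (P (Lev X setT))); last first.
      exact: le_lt_trans (probability_le1 _ (measurable_Lev mX _)) (ltry _).
    apply: ereal_inf_lbound; exists setT => //; split.
      by apply/regularP => //; apply: aeW => w; left; exists 0%N.
    by apply: aeW => w _; exists 0%N.
  by apply/ereal_infP => _ [A _ <-]; exact: measure_ge0.
have /choice[A PA] k : exists A, contains A /\
    P (Lev X A) < ereal_inf V + (k.+1%:R^-1)%:E.
  have k0 : (0 < k.+1%:R^-1 :> R)%R by rewrite invr_gt0.
  by have [_ [A cA <-]] := lb_ereal_inf_adherent k0 infV_fin; exists A.
(* B is the essential intersection of a minimizing sequence, so it attains the infimum. *)
have [B [rB LB]] := regular_bigcap mX tX (fun k => (PA k).1.1).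
have cB : contains B.
  split => //.
  have /ae_foralln : forall k, \forall w \ae P, Lev Y C w -> Lev X (A k) w.
    by move=> k; exact: (PA k).1.2.
  by apply: filterS2 LB => w -> LA LC k; exact: LA.
have minB : forall v, V v -> P (Lev X B) <= v.
  move=> v Vv; apply: le_trans (ereal_inf_lbound Vv).
  apply/lee_addgt0Pr => e e0.
  have [k ke] : exists k, (k.+1%:R^-1 < e)%R.
    by exists (Num.truncn e^-1); rewrite invf_plt ?posrE // truncnS_gt.
  apply: (@le_trans _ _ (P (Lev X (A k)))).
    apply: ae_le_measure; try exact: measurable_Lev.
    by apply: filterS LB => w ->.
  by apply: le_trans (ltW (PA k).2) _; rewrite leeD2l // lee_fin ltW.
have acB : almost_closed P X B.
  (* If B were transient, almost no path could settle in C along Y, and C, being regular, would be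
     transient. *)
  split => //; apply: contra_not ntC => /(transientP P mX) tB.
  apply/(transientP P mY); move/(regularP P mY) : rC.
  apply: filterS3 cB.2 tB => w CB tBw [/CB LB'|//].
  by case: (Lev_disjoint (setICr B) LB').
have [B1 [B2 [B1B B2B B12 acB1 acB2]]] := splitX B acB.
(* By minimality B' cannot be removed from B, so C meets it in a set that is not transient for Y;
   applied to both halves of B, this splits C. *)
have nt B' : B' `<=` B -> almost_closed P X B' -> almost_closed P Y (C `&` B').
  move=> B'B acB'; split.
    by apply: regularI => //; apply: regular_mstep => //; case: acB'.
  by move=> /(remove B B' cB B'B acB')[v /minB]; rewrite leNgt => /negP.
apply: nsC; exists (C `&` B1), (C `&` B2); split; try by move=> ? [].
- by rewrite setIACA B12 setI0.
- exact: nt.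
- exact: nt.
Qed.

End Skeleton.

Theorem theorem6 (R : realType) (S : countType) (d : measure_display)
    (T : measurableType d) (P : probability T R)
    (p : S -> S -> R) (X : nat -> T -> S)
    (S_infinite : infinite_set [set: S]%classic)
    (p_stochastic : stochastic p)
    (p_irreducible : irreducible p)
    (p_aperiodic : aperiodic p)
    (X_chain : markov_chain P p X)
    (X_simple_nonatomic : simple_nonatomic P X) :
  asymptotically_aperiodic P X.
Proof.
have [mX _] := X_chain.
have [splitX tX] := simple_nonatomicP mX X_simple_nonatomic.
rewrite /asymptotically_aperiodic /asymptotic_period.
(* Simplicity puts 1 in the set; any m >= 2 in it would yield an atomic set for [mstep m X]. *)
rewrite (_ : [set m | _] = [set 1%N]) ?image_set1 ?ereal_sup1 //.
apply/seteqP; split => [m [m1 betam]|_ ->] /=; last first.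
  by split => //; rewrite mstep1; case: X_simple_nonatomic.
have [m2|] := leqP 2 m; last first.
  by rewrite ltnS => m_le1; apply/eqP; rewrite eqn_leq m1 andbT.
have mY n i : measurable (mstep m X n @^-1` [set i]) by exact: mX.
have [C atC] := exists_atomic_of_beta m2 betam.
by case: (mstep_not_atomic mX m1 tX splitX atC).
Qed.
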